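(* For each $\rho\ge0$ let $u^\rho\in\mathbb R^{N\times d}$ be the solution of the penalized problem with zero switching cost $$F_i(u^{\rho})_l-\rho\sum_{j\neq i}\pi\big(u^{\rho,j}_l-u^{\rho,i}_l\big)=0,\qquad i\in\mathcal I,\ l\in\mathcal N.$$ Then $u^\rho$ converges monotonically from below, as $\rho\to\infty$, to the solution $\mathbf u$ of the following problem: find $\bar u\in\mathbb R^N$ such that $\mathbf u=(\bar u,\dots,\bar u)\in\mathbb R^{N\times d}$ satisfies $\min_{i\in\mathcal I}F_i(\mathbf u)=0$. Moreover, if $F$ is in addition locally Lipschitz continuous and there exist positive constants $\tau$ and $\sigma$ such that $\pi(y)\ge\tau y^{1/\sigma}$ for all $0\le y\le 2\|F(0)\|/\gamma$, then there is a constant $C_1>0$, independent of the penalty parameter $\rho$, such that $$0\le\mathbf u-u^\rho\le C_1/\rho^\sigma\qquad\text{for all }\rho>0.$$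
   Context: Let $N\ge1$ and $d\ge 2$ be integers, $\mathcal I=\{1,\dots,d\}$, $\mathcal N=\{1,\dots,N\}$. An element $u\in\mathbb R^{N\times d}$ is written $u=(u^1,\dots,u^d)$ with $u^i\in\mathbb R^N$ and entries $u^i_l$. Inequalities, minima and maxima of vectors/matrices are understood elementwise (also when comparing with a scalar). $\|\cdot\|$ is the sup-norm (maximum of absolute values of entries). ''Monotonically from below'' means $u^{\rho_1}\ge u^{\rho_2}$ whenever $\rho_1\ge\rho_2\ge0$. $F=(F_i)_{i\in\mathcal I}:\mathbb R^{N\times d}\to\mathbb R^{N\times d}$ (with $F_i(u)\in\mathbb R^N$) is a continuous function satisfying the monotonicity condition: there is a constant $\gamma>0$ such that for any $u,v\in\mathbb R^{N\times d}$, $i\in\mathcal I$, $l\in\mathcal N$ with $u^i_l-v^i_l=\max_{j\in\mathcal I,k\in\mathcal N}(u^j_k-v^j_k)\ge 0$, one has $F_i(u)_l-F_i(v)_l\ge\gamma(u^i_l-v^i_l)$. The penalty function $\pi:\mathbb R\to\mathbb R$ is a continuous non-decreasing function with $\pi|_{(-\infty,0]}=0$ and $\pi|_{(0,\infty)}>0$. The penalized problem has a unique solution for each $\rho\ge0$, and the problem $\min_{i\in\mathcal I}F_i(\mathbf u)=0$ has at most one solution of the form $\mathbf u=(\bar u,\dots,\bar u)$. *)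

(* Defs.v *)
From mathcomp Require Import all_boot all_order all_algebra.
From mathcomp Require Import all_classical all_reals all_analysis.
Set Implicit Arguments.
Unset Strict Implicit.
Unset Printing Implicit Defensive.
Import Order.TTheory GRing.Theory Num.Theory.
Import numFieldNormedType.Exports.
Local Open Scope classical_set_scope.
Local Open Scope ring_scope.

(* An element u = (u^1, ..., u^d) of R^(N x d) is a matrix whose column i is
   u^i: the entry u^i_l is [u l i]. MathComp-Analysis norms matrices by the
   largest absolute value of an entry. *)

(* As the base point of the iterated maximum or minimum is itself one of the
   entries, the result is the maximum or minimum of the entries. *)
Definition mxmax (R : realType) (m n : nat) (A : 'M[R]_(m.+1, n.+1)) : R :=
  \big[Num.max/A ord0 ord0]_(k : 'I_m.+1 * 'I_n.+1) A k.1 k.2.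

Definition min_columns (R : realType) (m n : nat) (A : 'M[R]_(m.+1, n.+1)) :
    'cV[R]_m.+1 :=
  \col_l \big[Num.min/A l ord0]_(i < n.+1) A l i.

Definition repeat_column (R : realType) (m n : nat) (w : 'cV[R]_m) :
    'M[R]_(m, n) :=
  \matrix_(l, i) w l ord0.

Definition monotonicity_condition (R : realType) (m n : nat)
    (F : 'M[R]_(m.+1, n.+1) -> 'M[R]_(m.+1, n.+1)) (gamma : R) : Prop :=
  forall (u v : 'M[R]_(m.+1, n.+1)) (l : 'I_m.+1) (i : 'I_n.+1),
    u l i - v l i = mxmax (u - v) -> 0 <= mxmax (u - v) ->
    gamma * (u l i - v l i) <= F u l i - F v l i.

Definition penalty_function (R : realType) (p : R -> R) : Prop :=
  [/\ continuous p,
      {homo p : x y / x <= y},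
      (forall y, y <= 0 -> p y = 0) &
      (forall y, 0 < y -> 0 < p y)].

Definition penalized_solution (R : realType) (m n : nat)
    (F : 'M[R]_(m, n) -> 'M[R]_(m, n)) (p : R -> R) (rho : R)
    (u : 'M[R]_(m, n)) : Prop :=
  forall (i : 'I_n) (l : 'I_m),
    F u l i - rho * \sum_(j < n | j != i) p (u l j - u l i) = 0.

Definition min_problem_solution (R : realType) (m n : nat)
    (F : 'M[R]_(m.+1, n.+1) -> 'M[R]_(m.+1, n.+1)) (w : 'cV[R]_m.+1) : Prop :=
  min_columns (F (repeat_column n.+1 w)) = 0.

Definition locally_lipschitz (R : realType) (V W : normedModType R)
    (f : V -> W) : Prop :=
  forall x : V, exists2 A : set V, nbhs x A & [lipschitz f y | y in A].

(* Main.v *)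
(* At a maximal entry (l, i) of u - v every gap u^j_l - u^i_l is at most
   v^j_l - v^i_l, so the monotonicity of F survives the penalty term. Evaluated
   at such an entry, the equations give u^rho2 <= u^rho1 for rho2 <= rho1 and
   |u^rho| <= |F 0| / gamma, hence a monotone limit U. Dividing the equation by
   rho shows that the penalty vanishes at U, so U has equal columns; in every
   row F(u^rho) is nonnegative and vanishes in the column where u^rho is
   largest, hence min_i F_i(U) = 0.
   For the rate, F(u^rho) <= B for large rho, so the growth of the penalty
   bounds the gaps between columns by d = (B / (tau rho))^sigma. Repeating one
   column of u^rho gives z with |z - u^rho| <= d, so F(z) >= - L d with L a
   Lipschitz constant near U, and comparing U with z gives
   U - z <= L d / gamma. For the remaining bounded range of rho the bound
   |u^rho| <= |F 0| / gamma suffices. *)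

Require Import Defs.
From mathcomp Require Import all_boot all_order all_algebra.
From mathcomp Require Import all_classical all_reals all_analysis.
From mathcomp Require Import ring lra.
Set Implicit Arguments.
Unset Strict Implicit.
Unset Printing Implicit Defensive.
Import Order.TTheory GRing.Theory Num.Theory.
Import numFieldNormedType.Exports.
Local Open Scope classical_set_scope.
Local Open Scope ring_scope.

(** * Entrywise norms, limits and extremal entries of matrices *)

Lemma norm_entry_le (R : realType) (m n : nat) (A : 'M[R]_(m, n)) l i :
  `|A l i| <= `|A|.
Proof.
rewrite [leRHS]/Num.Def.normr /= mx_normrE.
by apply: le_trans (le_bigmax _ _ (l, i)).
Qed.

Lemma norm_mx_le (R : realType) (m n : nat) (A : 'M[R]_(m, n)) (e : R) :
  0 <= e -> (forall l i, `|A l i| <= e) -> `|A| <= e.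
Proof.
move=> e0 Ae; rewrite [leLHS]/Num.Def.normr /= mx_normrE.
by apply: bigmax_le => // -[l i] _; exact: Ae.
Qed.

Lemma mx_cvgr (R : realType) (m n : nat) (T : Type) (G : set_system T)
    (f : T -> 'M[R]_(m, n)) (A : 'M[R]_(m, n)) : Filter G ->
  (forall l i, f x l i @[x --> G] --> A l i) -> f @ G --> A.
Proof.
move=> FG fA; apply/cvgrPdist_le => e e0.
have : \forall x \near G, forall l i, `|A l i - f x l i| <= e.
  apply: filter_forall => l; apply: filter_forall => i.
  by move/cvgrPdist_le : (fA l i); exact.
apply: filterS => x Afx; apply: norm_mx_le (ltW e0) _ => l i.
by rewrite !mxE.
Qed.

Lemma le_mxmax (R : realType) (m n : nat) (A : 'M[R]_(m.+1, n.+1)) l i :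
  A l i <= mxmax A.
Proof. exact: (le_bigmax _ (fun k => A k.1 k.2) (l, i)). Qed.

Lemma mxmax_attained (R : realType) (m n : nat) (A : 'M[R]_(m.+1, n.+1)) :
  exists l i, A l i = mxmax A.
Proof.
rewrite /mxmax; elim/big_ind : _ => [|x y [l [i <-]] [k [j <-]]|[l i] _].
- by exists ord0, ord0.
- by case: leP => _; [exists k, j|exists l, i].
- by exists l, i.
Qed.

Lemma min_columns_eq0 (R : realType) (m n : nat) (A : 'M[R]_(m.+1, n.+1)) :
  min_columns A = 0 <->
  forall l, (forall i, 0 <= A l i) /\ exists i, A l i = 0.
Proof.
split=> [/colP A0 l|A0].
  have := A0 l; rewrite !mxE => Al0; split=> [i|].
    by rewrite -Al0; exact: bigmin_le.
  rewrite -Al0; elim/big_ind : _ => [|x y [i <-] [j <-]|i _].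
  - by exists ord0.
  - by case: leP => _; [exists i|exists j].
  - by exists i.
apply/colP => l; rewrite !mxE; have [Age0 [i Ai0]] := A0 l.
apply/eqP; rewrite eq_le -{1}Ai0 bigmin_le/=.
by apply/bigmin_geP; split.
Qed.

(** * Comparison principles from the monotonicity condition *)

Lemma maximal_difference (R : realType) (m n : nat)
    (u v : 'M[R]_(m.+1, n.+1)) :
  exists l i, forall k j, u k j - v k j <= u l i - v l i.
Proof.
have [l [i li]] := mxmax_attained (u - v); exists l, i => k j.
by have := le_mxmax (u - v) k j; rewrite -li !mxE.
Qed.

Lemma monotone_at_max (R : realType) (m n : nat)
    (F : 'M[R]_(m.+1, n.+1) -> 'M[R]_(m.+1, n.+1)) (gamma : R)
    (u v : 'M[R]_(m.+1, n.+1)) l i :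
  monotonicity_condition F gamma ->
  (forall k j, u k j - v k j <= u l i - v l i) -> 0 <= u l i - v l i ->
  gamma * (u l i - v l i) <= F u l i - F v l i.
Proof.
move=> Fmono uv_le; have [k [j kj]] := mxmax_attained (u - v).
suff liE : u l i - v l i = mxmax (u - v) by rewrite {1}liE; exact: Fmono.
apply/eqP; rewrite eq_le; apply/andP; split; last by rewrite -kj !mxE.
by have := le_mxmax (u - v) l i; rewrite !mxE.
Qed.

(** The largest entry of [u - v] controls all others. If it is positive, monotonicity bounds [gamma]
    times it by the difference of [F], hence by [e]; otherwise [0 <= e] suffices. *)
Lemma comparison (R : realType) (m n : nat)
    (F : 'M[R]_(m.+1, n.+1) -> 'M[R]_(m.+1, n.+1)) (gamma e : R)
    (u v : 'M[R]_(m.+1, n.+1)) :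
  0 < gamma -> monotonicity_condition F gamma -> 0 <= e ->
  (forall l i, (forall k j, u k j - v k j <= u l i - v l i) ->
     F u l i - F v l i <= e) ->
  forall l i, u l i - v l i <= e / gamma.
Proof.
move=> gamma0 Fmono e0 Fe l i.
have [k [j uv_le]] := maximal_difference u v.
apply: (le_trans (uv_le l i)).
have [uv0|uv0] := leP (u k j - v k j) 0.
  by rewrite (le_trans uv0)// divr_ge0// ltW.
rewrite ler_pdivlMr// mulrC; apply: le_trans (Fe k j uv_le).
by apply: monotone_at_max => //; exact: ltW.
Qed.

(* The difference of two constant-column matrices is maximal along a whole row,
   so the comparison can be made in the column where the minimum is attained. *)
Lemma comparison_repeat_column (R : realType) (m n : nat)
    (F : 'M[R]_(m.+1, n.+1) -> 'M[R]_(m.+1, n.+1)) (gamma e : R)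
    (w z : 'cV[R]_m.+1) :
  0 < gamma -> monotonicity_condition F gamma -> 0 <= e ->
  min_problem_solution F w ->
  (forall l i, - e <= F (repeat_column n.+1 z) l i) ->
  forall l, w l ord0 - z l ord0 <= e / gamma.
Proof.
move=> gamma0 Fmono e0 /min_columns_eq0 Fw Fz l.
have [k [j]] :=
  maximal_difference (repeat_column n.+1 w) (repeat_column n.+1 z).
rewrite !mxE => wz_le; have := wz_le l ord0; rewrite !mxE.
move=> /le_trans; apply.
have [wz0|wz0] := leP (w k ord0 - z k ord0) 0.
  by rewrite (le_trans wz0)// divr_ge0// ltW.
have [_ [i Fi0]] := Fw k; rewrite ler_pdivlMr// mulrC.
have := @monotone_at_max _ _ _ _ _ (repeat_column n.+1 w)
  (repeat_column n.+1 z) k i Fmono.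
rewrite !mxE Fi0 => /(_ wz_le (ltW wz0)) /le_trans; apply.
by rewrite sub0r lerNl Fz.
Qed.

(** * The penalty term and bounds for penalized solutions *)

Definition penalty (R : realType) (m n : nat) (p : R -> R)
    (u : 'M[R]_(m, n)) (l : 'I_m) (i : 'I_n) : R :=
  \sum_(j < n | j != i) p (u l j - u l i).

Lemma penalized_solutionE (R : realType) (m n : nat)
    (F : 'M[R]_(m, n) -> 'M[R]_(m, n)) (p : R -> R) (rho : R)
    (u : 'M[R]_(m, n)) :
  penalized_solution F p rho u ->
  forall l i, F u l i = rho * penalty p u l i.
Proof. by move=> u_sol l i; apply/eqP; rewrite -subr_eq0 u_sol. Qed.

Lemma penalty_function_ge0 (R : realType) (p : R -> R) y :
  penalty_function p -> 0 <= p y.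
Proof.
move=> [_ _ p0 p_gt0]; have [y0|y0] := leP y 0; first by rewrite p0.
exact/ltW/p_gt0.
Qed.

Lemma penalty_ge0 (R : realType) (m n : nat) (p : R -> R)
    (u : 'M[R]_(m, n)) l i : penalty_function p -> 0 <= penalty p u l i.
Proof. by move=> p_pen; apply: sumr_ge0 => j _; exact: penalty_function_ge0. Qed.

Lemma penalty_ge_term (R : realType) (m n : nat) (p : R -> R)
    (u : 'M[R]_(m, n)) l i j :
  penalty_function p -> p (u l j - u l i) <= penalty p u l i.
Proof.
move=> p_pen; have [->|ji] := eqVneq j i.
  (* The sum omits the index [i], but for [j = i] the left side is [p 0 = 0]. *)
  by have [_ _ p0 _] := p_pen; rewrite subrr p0// penalty_ge0.
rewrite /penalty (bigD1 j)//= lerDl.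
by apply: sumr_ge0 => k _; exact: penalty_function_ge0.
Qed.

Lemma penalty_row_max (R : realType) (m n : nat) (p : R -> R)
    (u : 'M[R]_(m, n)) l i :
  penalty_function p -> (forall j, u l j <= u l i) -> penalty p u l i = 0.
Proof. by move=> [_ _ p0 _] u_le; apply: big1 => j _; rewrite p0// subr_le0. Qed.

(** The hypothesis rearranges to an inequality between the gaps within row [l], which the monotone
    [p] preserves term by term. *)
Lemma penalty_le (R : realType) (m n : nat) (p : R -> R)
    (u v : 'M[R]_(m, n)) l i :
  penalty_function p -> (forall j, u l j - v l j <= u l i - v l i) ->
  penalty p u l i <= penalty p v l i.
Proof.
move=> [_ p_homo _ _] uv_le; apply: ler_sum => j _; apply: p_homo.
have := uv_le j; lra.
Qed.

Lemma row_max (R : realType) (m n : nat) (u : 'M[R]_(m, n.+1)) l :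
  exists i, forall j, u l j <= u l i.
Proof.
by have [i _ ui] := @arg_maxP _ _ _ ord0 predT (u l) isT;
  exists i => j; exact: ui.
Qed.

Lemma penalized_ge0 (R : realType) (m n : nat)
    (F : 'M[R]_(m, n) -> 'M[R]_(m, n)) (p : R -> R) (rho : R)
    (u : 'M[R]_(m, n)) :
  penalty_function p -> 0 <= rho -> penalized_solution F p rho u ->
  forall l i, 0 <= F u l i.
Proof.
move=> p_pen rho0 /penalized_solutionE FE l i.
by rewrite FE mulr_ge0// penalty_ge0.
Qed.

(** Comparison with [e = 0]: where [v - u] is maximal, [v] has both the smaller penalty and the
    smaller factor [rho2], so [F v] does not exceed [F u] there. *)
Lemma penalized_monotone (R : realType) (m n : nat)
    (F : 'M[R]_(m.+1, n.+1) -> 'M[R]_(m.+1, n.+1)) (gamma : R)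
    (p : R -> R) (rho1 rho2 : R) (u v : 'M[R]_(m.+1, n.+1)) :
  0 < gamma -> monotonicity_condition F gamma -> penalty_function p ->
  0 <= rho2 -> rho2 <= rho1 ->
  penalized_solution F p rho1 u -> penalized_solution F p rho2 v ->
  forall l i, v l i <= u l i.
Proof.
move=> gamma0 Fmono p_pen rho20 rho21 /penalized_solutionE FE
  /penalized_solutionE FE' l i.
rewrite -subr_le0 -(mul0r gamma^-1).
apply: (comparison gamma0 Fmono (lexx 0)) => {l i} l i vu_le.
rewrite subr_le0 FE FE'; apply: ler_pM => //; first exact: penalty_ge0.
exact: penalty_le.
Qed.

(** Comparison with the zero matrix on both sides. The lower bound uses that [F u] is nonnegative;
    for the upper one, a maximal entry of [u] has no penalty, so [F u] vanishes there. *)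
Lemma penalized_bound (R : realType) (m n : nat)
    (F : 'M[R]_(m.+1, n.+1) -> 'M[R]_(m.+1, n.+1)) (gamma : R)
    (p : R -> R) (rho : R) (u : 'M[R]_(m.+1, n.+1)) :
  0 < gamma -> monotonicity_condition F gamma -> penalty_function p ->
  0 <= rho -> penalized_solution F p rho u ->
  forall l i, `|u l i| <= `|F 0| / gamma.
Proof.
move=> gamma0 Fmono p_pen rho0 u_sol l i.
have F0_le k j : `|F 0 k j| <= `|F 0| by exact: norm_entry_le.
rewrite ler_norml; apply/andP; split.
  rewrite lerNl; have -> : - u l i = (0 : 'M[R]_(m.+1, n.+1)) l i - u l i.
    by rewrite mxE sub0r.
  apply: (comparison gamma0 Fmono) => // k j _.
  have := penalized_ge0 p_pen rho0 u_sol k j.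
  by have := F0_le k j; rewrite ler_norml => /andP[_]; lra.
have -> : u l i = u l i - (0 : 'M[R]_(m.+1, n.+1)) l i by rewrite mxE subr0.
apply: (comparison gamma0 Fmono) => // k j u_le.
rewrite (penalized_solutionE u_sol) penalty_row_max ?mulr0//.
  by have := F0_le k j; rewrite ler_norml => /andP[+ _]; lra.
by move=> j'; have := u_le k j'; rewrite !mxE !subr0.
Qed.

(** * Passage to the limit in the penalized equations *)

Lemma penalized_limit (R : realType) (m n : nat)
    (F : 'M[R]_(m, n.+1) -> 'M[R]_(m, n.+1)) (p : R -> R)
    (u : R -> 'M[R]_(m, n.+1)) (U : 'M[R]_(m, n.+1)) :
  continuous F -> penalty_function p ->
  (forall rho, 0 <= rho -> penalized_solution F p rho (u rho)) ->
  u rho @[rho --> +oo] --> U ->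
  U = repeat_column n.+1 (col ord0 U) /\
  forall l, (forall i, 0 <= F U l i) /\ exists i, F U l i = 0.
Proof.
move=> F_cont p_pen u_sol uU.
have [p_cont _ p0 p_gt0] := p_pen.
have cvg_entry (f : R -> 'M[R]_(m, n.+1)) (A : 'M[R]_(m, n.+1)) l i :
    f rho @[rho --> +oo] --> A -> f rho l i @[rho --> +oo] --> A l i.
  move=> fA; apply: (@continuous_cvg _ _ _ _ _ f
      (fun M : 'M[R]_(m, n.+1) => M l i) A _ fA).
  exact: coord_continuous.
have FuU : F (u rho) @[rho --> +oo] --> F U.
  by apply: (continuous_cvg _ (F_cont U) uU).
have rho_gt0 : \forall rho \near +oo, (0 : R) < rho by exact: nbhs_pinfty_gt.
have U_le l i j : U l j <= U l i.
  rewrite leNgt; apply/negP => U_lt.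
  have y_gt0 : 0 < p (U l j - U l i) by apply: p_gt0; rewrite subr_gt0.
  have cvgp : p (u rho l j - u rho l i) @[rho --> +oo] --> p (U l j - U l i).
    apply: (continuous_cvg _ (p_cont _)).
    by apply: cvgB; exact: cvg_entry.
  have cvgF : rho^-1 * F (u rho) l i @[rho --> +oo] --> 0 * F U l i.
    apply: cvgM; last exact: cvg_entry.
    by apply/gtr0_cvgV0 => //; exact: cvg_id.
  suff : p (U l j - U l i) <= 0 by rewrite leNgt y_gt0.
  rewrite -(mul0r (F U l i)); apply: (ler_cvg_to cvgp cvgF).
  apply: filterS rho_gt0 => rho rho0.
  rewrite (penalized_solutionE (u_sol _ (ltW rho0))) mulKf ?gt_eqF//.
  exact: penalty_ge_term.
split.
  by apply/matrixP => l i; rewrite !mxE; apply/eqP; rewrite eq_le !U_le.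
move=> l.
have F_ge0 i : 0 <= F U l i.
  have cvgF := cvg_entry _ _ l i FuU.
  apply: (ler_cvg_to (cvg_cst 0) cvgF).
  apply: filterS rho_gt0 => rho rho0.
  exact: (penalized_ge0 p_pen (ltW rho0) (u_sol _ (ltW rho0))).
(* The column of the row maximum may change with [rho]. Arguing by contradiction, positivity in all
   of the finitely many columns persists for some large [rho], whatever that column is. *)
split => //; apply: contrapT => F_neq0.
have F_gt0 i : 0 < F U l i.
  by rewrite lt_def F_ge0 andbT; apply/negP => /eqP Fi0; apply: F_neq0; exists i.
have Fu_gt0 : \forall rho \near +oo, forall i, 0 < F (u rho) l i.
  apply: filter_forall => i.
  exact: (cvgr_gt _ (cvg_entry _ _ l i FuU) _ (F_gt0 i)).
have [rho rho0 Furho] := pinfty_ex_gt0 Fu_gt0.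
have [i u_le] := row_max (u rho) l.
have := Furho i; rewrite (penalized_solutionE (u_sol _ (ltW rho0))).
by rewrite penalty_row_max// mulr0 ltxx.
Qed.

(** * The rate of convergence *)

Lemma penalized_gap (R : realType) (m n : nat)
    (F : 'M[R]_(m, n) -> 'M[R]_(m, n)) (p : R -> R) (rho B Y tau sigma : R)
    (u : 'M[R]_(m, n)) :
  penalty_function p -> 0 < rho -> penalized_solution F p rho u ->
  0 <= B -> (forall l i, F u l i <= B) ->
  (forall l i j, u l j - u l i <= Y) ->
  0 < tau -> 0 < sigma ->
  (forall y, 0 <= y -> y <= Y -> tau * y `^ (1 / sigma) <= p y) ->
  forall l i j, u l j - u l i <= (B / tau) `^ sigma / rho `^ sigma.
Proof.
move=> p_pen rho0 /penalized_solutionE FE B0 FB uY tau0 sigma0 p_ge l i j.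
have [y0|/ltW y0] := leP (u l j - u l i) 0.
  by rewrite (le_trans y0)// divr_ge0 ?powR_ge0.
set y := u l j - u l i in y0 *.
have rho_neq0 : rho `^ sigma != 0 by rewrite gt_eqF// powR_gt0.
(* A single summand is at most the whole penalty, which is at most [B / rho] by the equation. *)
have y_le : y `^ (1 / sigma) <= B / tau / rho.
  rewrite !ler_pdivlMr// mulrAC mulrC (mulrC _ tau).
  have := FB l i; rewrite FE; apply: le_trans.
  rewrite ler_pM2l//; apply: le_trans (penalty_ge_term u l i j p_pen).
  by apply: p_ge => //; exact: uY.
have -> : y = (y `^ (1 / sigma)) `^ sigma.
  by rewrite -powRrM mul1r mulVf ?gt_eqF// powRr1.
have Bt_ge0 : 0 <= B / tau / rho by rewrite !divr_ge0// ltW.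
have -> : (B / tau) `^ sigma / rho `^ sigma = (B / tau / rho) `^ sigma.
  rewrite -{1}(@divfK _ rho _ (B / tau)) ?gt_eqF//.
  by rewrite (powRM _ Bt_ge0 (ltW rho0)) mulfK.
by apply: ge0_ler_powR => //; [exact: ltW|rewrite nnegrE powR_ge0].
Qed.

Lemma penalized_rate (R : realType) (m n : nat)
    (F : 'M[R]_(m.+1, n.+1) -> 'M[R]_(m.+1, n.+1)) (gamma : R)
    (p : R -> R) (u : R -> 'M[R]_(m.+1, n.+1)) (w : 'cV[R]_m.+1)
    (tau sigma : R) :
  continuous F -> 0 < gamma -> monotonicity_condition F gamma ->
  penalty_function p ->
  (forall rho, 0 <= rho -> penalized_solution F p rho (u rho)) ->
  min_problem_solution F w ->
  (forall rho l i, 0 <= rho -> u rho l i <= w l ord0) ->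
  u rho @[rho --> +oo] --> repeat_column n.+1 w ->
  locally_lipschitz F -> 0 < tau -> 0 < sigma ->
  (forall y, 0 <= y -> y <= 2 * `|F 0| / gamma ->
     tau * y `^ (1 / sigma) <= p y) ->
  exists C, 0 < C /\ forall rho, 0 < rho ->
    forall l i, w l ord0 - u rho l i <= C / rho `^ sigma.
Proof.
move=> F_cont gamma0 Fmono p_pen u_sol w_sol u_le uU F_lip tau0 sigma0 p_ge.
set U := repeat_column n.+1 w in uU *.
have [A /nbhs_ballP[e /= e0 UeA]] := F_lip U.
move=> /pinfty_ex_gt0[L L0 LipA].
have uK rho l i : 0 <= rho -> `|u rho l i| <= `|F 0| / gamma.
  by move=> rho0; exact: penalized_bound (u_sol _ rho0) l i.
have near_ball : \forall rho \near +oo, ball U e (u rho).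
  exact: (cvg_ball uU).
have near_bound : \forall rho \near +oo, `|F (u rho)| < `|F U| + 1.
  have FuU : F (u rho) @[rho --> +oo] --> F U.
    by apply: (continuous_cvg _ (F_cont U) uU).
  by apply: (cvgr_norm_lt _ FuU); rewrite ltrDl.
have [rho0 [rho0_gt0 rho0_near]] : exists rho0 : R, 0 < rho0 /\
    forall rho, rho0 < rho -> ball U e (u rho) /\ `|F (u rho)| < `|F U| + 1.
  have [M [_ Mnear]] := filterI near_ball near_bound.
  (* The maximum with 1 makes the threshold positive. *)
  exists (Num.max M 1); split; first by rewrite lt_max ltr01 orbT.
  by move=> rho; rewrite gt_max => /andP[/Mnear].
pose K := `|F 0| / gamma; pose c := ((`|F U| + 1) / tau) `^ sigma.
have K0 : 0 <= K by rewrite divr_ge0// ltW.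
have c0 : 0 <= c by exact: powR_ge0.
(* [C1] serves [rho <= rho0], where the error is at most [2 * K]. [C2] serves larger [rho]: 1 for
   the gap between columns, [L / gamma] for the comparison of [w] with one column. The final [+ 1]
   gives strict positivity. *)
pose C1 := 2 * K * rho0 `^ sigma; pose C2 := (1 + L / gamma) * c.
have C10 : 0 <= C1 by rewrite mulr_ge0 ?powR_ge0// mulr_ge0.
have C20 : 0 <= C2 by rewrite mulr_ge0// addr_ge0// divr_ge0// ltW.
exists (C1 + C2 + 1); split; first by rewrite ltr_wpDl// addr_ge0.
move=> rho rho_gt0 l i.
have rhos_gt0 : 0 < rho `^ sigma by exact: powR_gt0.
have [rho_le|rho_gt] := leP rho rho0.
  have wK : w l ord0 <= K.
    have cvgu : u r l i @[r --> +oo] --> w l ord0.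
      have -> : w l ord0 = U l i by rewrite mxE.
      apply: (@continuous_cvg _ _ _ _ _ u
        (fun M : 'M[R]_(m.+1, n.+1) => M l i) U _ uU).
      exact: coord_continuous.
    apply: (ler_cvg_to cvgu (cvg_cst K)).
    have := @nbhs_pinfty_ge R 0 (real0 _); apply: filterS => r r0.
    by apply: le_trans (uK _ _ _ r0); exact: ler_norm.
  have uK' : - K <= u rho l i.
    by have := uK rho l i (ltW rho_gt0); rewrite ler_norml => /andP[].
  rewrite ler_pdivlMr//; apply: (@le_trans _ _ C1); last first.
    by rewrite -addrA lerDl addr_ge0.
  have rhos_le : rho `^ sigma <= rho0 `^ sigma.
    by apply: ge0_ler_powR => //; rewrite ?nnegrE ltW.
  apply: ler_pM => //; [|exact: ltW|].
    by rewrite subr_ge0 u_le// ltW.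
  lra.
have [uU_ball FuB] := rho0_near _ rho_gt.
pose d := c / rho `^ sigma.
have d0 : 0 <= d by rewrite divr_ge0// ltW.
have gap k j j' : u rho k j' - u rho k j <= d.
  apply: (@penalized_gap _ _ _ F p rho (`|F U| + 1) (2 * `|F 0| / gamma)) => //.
  - exact/u_sol/ltW.
  - move=> k' j0; apply: le_trans (ltW FuB).
    by apply: le_trans (norm_entry_le _ k' j0); exact: ler_norm.
  - move=> k' j1 j2.
    have := uK rho k' j1 (ltW rho_gt0); have := uK rho k' j2 (ltW rho_gt0).
    rewrite !ler_norml -mulrA => /andP[_ h1] /andP[h2 _]; lra.
pose z := col ord0 (u rho).
(* As [U] has equal columns, repeating a column of [u rho] stays in the ball around [U], where the
   Lipschitz bound holds. *)
have Az : A (repeat_column n.+1 z).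
  apply: UeA; split => // k j; have [_ /(_ k ord0)] := uU_ball.
  by rewrite !mxE.
have Au : A (u rho) by exact: UeA.
have zu : `|u rho - repeat_column n.+1 z| <= d.
  apply: norm_mx_le => // k j; rewrite !mxE ler_norml.
  by rewrite gap andbT lerNl opprB gap.
have Fz k j : - (L * d) <= F (repeat_column n.+1 z) k j.
  have Fuz : `|F (u rho) - F (repeat_column n.+1 z)| <= L * d.
    apply: (le_trans (LipA (u rho, repeat_column n.+1 z) _)) => //=.
    by rewrite ler_pM2l.
  have := norm_entry_le (F (u rho) - F (repeat_column n.+1 z)) k j.
  move=> /le_trans /(_ Fuz); rewrite !mxE ler_norml => /andP[_].
  have := penalized_ge0 p_pen (ltW rho_gt0) (u_sol _ (ltW rho_gt0)) k j; lra.
have Ld0 : 0 <= L * d by rewrite mulr_ge0// ltW.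
have := comparison_repeat_column gamma0 Fmono Ld0 w_sol Fz l.
(* The error splits as [w - z] plus the gap from column [i] to column [ord0]. *)
rewrite mxE; have := gap l i ord0 => gapi wz.
apply: (@le_trans _ _ (C2 / rho `^ sigma)); last first.
  by rewrite ler_pM2r ?invr_gt0//; lra.
have -> : C2 / rho `^ sigma = d + L * d / gamma.
  by rewrite /C2 /d; field; rewrite !gt_eqF.
lra.
Qed.

(* There are N.+1 >= 1 rows and d.+2 >= 2 columns. *)
Theorem theorem4p2 (R : realType) (N d : nat)
    (F : 'M[R]_(N.+1, d.+2) -> 'M[R]_(N.+1, d.+2)) (gamma : R)
    (p : R -> R) (u : R -> 'M[R]_(N.+1, d.+2))
    (F_continuous : continuous F)
    (gamma_gt0 : 0 < gamma)
    (F_monotone : monotonicity_condition F gamma)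
    (p_penalty : penalty_function p)
    (u_solution : forall rho : R, 0 <= rho ->
       penalized_solution F p rho (u rho)) :
  exists w : 'cV[R]_N.+1,
    [/\ min_problem_solution F w,
        (forall w' : 'cV[R]_N.+1, min_problem_solution F w' -> w' = w),
        (forall rho1 rho2 : R, 0 <= rho2 -> rho2 <= rho1 ->
           forall (l : 'I_N.+1) (i : 'I_d.+2), u rho2 l i <= u rho1 l i),
        u rho @[rho --> +oo] --> repeat_column d.+2 w &
        locally_lipschitz F ->
        forall tau sigma : R, 0 < tau -> 0 < sigma ->
        (forall y : R, 0 <= y -> y <= 2 * `|F 0| / gamma ->
           tau * y `^ (1 / sigma) <= p y) ->
        exists C1 : R, 0 < C1 /\
          forall rho : R, 0 < rho ->
          forall (l : 'I_N.+1) (i : 'I_d.+2),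
            0 <= (repeat_column d.+2 w - u rho) l i <= C1 / rho `^ sigma].
Proof.
have u_mono (rho1 rho2 : R) : 0 <= rho2 -> rho2 <= rho1 ->
    forall l i, u rho2 l i <= u rho1 l i.
  move=> rho2_ge0 le_rho.
  exact: (penalized_monotone gamma_gt0 F_monotone p_penalty rho2_ge0 le_rho
    (u_solution _ (le_trans rho2_ge0 le_rho)) (u_solution _ rho2_ge0)).
have rho_ge0 : \forall rho \near +oo, (0 : R) <= rho by exact: nbhs_pinfty_ge.
(* Nothing is known about [u] at negative parameters; truncating at 0 makes each entry nondecreasing
   and bounded on the whole line. *)
pose v l i (rho : R) := u (Num.max rho 0) l i.
pose U : 'M[R]_(N.+1, d.+2) := \matrix_(l, i) sup (range (v l i)).
have v_ub l i : has_ubound (range (v l i)).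
  exists (`|F 0| / gamma) => _ [rho _ <-]; apply: (le_trans (ler_norm _)).
  have max_ge0 : 0 <= Num.max rho 0 by rewrite le_max lexx orbT.
  exact: (penalized_bound gamma_gt0 F_monotone p_penalty max_ge0
    (u_solution _ max_ge0)).
have uU : u rho @[rho --> +oo] --> U.
  apply: mx_cvgr => l i; rewrite mxE.
  have v_cvg : v l i rho @[rho --> +oo] --> sup (range (v l i)).
    apply: nondecreasing_cvgr (v_ub l i) => rho1 rho2 le_rho.
    apply: u_mono; first by rewrite le_max lexx orbT.
    by rewrite ge_max !le_max le_rho lexx orbT.
  apply: cvg_trans v_cvg; apply: near_eq_cvg.
  by apply: filterS rho_ge0 => rho rho0; rewrite /v max_l.
have [UE FU] := penalized_limit F_continuous p_penalty u_solution uU.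
pose w := col ord0 U; have w_sol : min_problem_solution F w.
  by apply/min_columns_eq0; rewrite -UE.
(* Comparison with [e = 0]; used in both directions it yields uniqueness. *)
have solution_le (w1 w2 : 'cV[R]_N.+1) :
    min_problem_solution F w1 -> min_problem_solution F w2 ->
    forall l, w1 l ord0 <= w2 l ord0.
  move=> w1_sol /min_columns_eq0 w2_sol l; rewrite -subr_le0 -(mul0r gamma^-1).
  apply: (comparison_repeat_column gamma_gt0 F_monotone (lexx 0) w1_sol).
  by move=> k i; rewrite oppr0; exact: (w2_sol k).1.
have u_le (rho : R) l i : 0 <= rho -> u rho l i <= w l ord0.
  move=> rho0; have -> : w l ord0 = U l i by rewrite /w mxE UE !mxE.
  rewrite mxE; have -> : u rho l i = v l i rho by rewrite /v max_l.
  by apply: ub_le_sup => //; exists rho.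
exists w; split => //.
- by move=> w' w'_sol; apply/colP => l; apply/eqP; rewrite eq_le !solution_le.
- by rewrite -UE.
- move=> F_lip tau sigma tau0 sigma0 p_ge.
  have uw : u rho @[rho --> +oo] --> repeat_column d.+2 w by rewrite -UE.
  have [C1 [C10 wu_le]] := penalized_rate F_continuous gamma_gt0 F_monotone
    p_penalty u_solution w_sol u_le uw F_lip tau0 sigma0 p_ge.
  exists C1; split => // rho rho0 l i.
  have -> : (repeat_column d.+2 w - u rho) l i = w l ord0 - u rho l i.
    by rewrite !mxE.
  by rewrite subr_ge0 wu_le// andbT u_le// ltW.
Qed.
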